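(* Let $\Gamma$ be a numerical semigroup. Let $I\cong(1,x^s)$ be a fractional ideal of $k[\Gamma]$, for some field $k$ and some $s\in\mathbb{N}$. Then the length of $\mathrm{T}(I\otimes_{k[\Gamma]}I^* )$ as a $k[\Gamma]$-module is equal to the number of irreducible arithmetic-sequences in $\Gamma$ of the form $(x,x+s,x+2s)$.
   Context: A numerical semigroup is a submonoid of $(\mathbb{N}_0,+)$ with finite complement in $\mathbb{N}_0$. $k[\Gamma]$ is the subalgebra of the polynomial ring $k[x]$ spanned over $k$ by the monomials $x^\gamma$, $\gamma\in\Gamma$. $\mathrm{T}(M)$ is the torsion submodule of $M$, and $I^*=\operatorname{Hom}_{k[\Gamma]}(I,k[\Gamma])$. A fractional ideal is a (nonzero) finitely generated submodule of the field of fractions; $(1,x^s)$ is the one generated by $1$ and $x^s$. $\mathbb{N}$ denotes the positive integers. An arithmetic-sequence over (or in) $\Gamma$ with step size $s$ is a sequence of integers $(x,x+s,x+2s,\ldots,x+ns)$ with $n>0$ such that $x+is\in\Gamma$ for $i=0,\ldots,n$. The sum of two arithmetic-sequences with the same step size $s$ is $(y,y+s,\ldots,y+as)+(z,z+s,\ldots,z+bs):=(y+z,y+z+s,\ldots,y+z+(a+b)s)$, which is again an arithmetic-sequence over $\Gamma$. An arithmetic-sequence is irreducible if it is not the sum of two arithmetic-sequences over $\Gamma$ with step size $s$. *)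

(* Defs.v *)
From HB Require Import structures.
From mathcomp Require Import all_boot all_order all_algebra.
From mathcomp Require Import generic_quotient ring_quotient fraction.
From mathcomp Require Import boolp classical_sets functions cardinality.
From mathcomp Require Import freeg.

Set Implicit Arguments.
Unset Strict Implicit.
Unset Printing Implicit Defensive.

Import GRing.Theory.
Local Open Scope classical_set_scope.
Local Open Scope ring_scope.
Local Open Scope quotient_scope.

Section Span.
Variables (R : nzRingType) (V : lmodType R) (A : set V).

Definition lspan : {pred V} := [pred v | `[<
  exists2 r : seq (R * V), (forall t, t \in r -> A t.2) &
    v = \sum_(t <- r) t.1 *: t.2 >] ].

Lemma lspanP v : reflect
  (exists2 r : seq (R * V), (forall t, t \in r -> A t.2) &
     v = \sum_(t <- r) t.1 *: t.2) (v \in lspan).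
Proof. exact: asboolP. Qed.

Lemma mem_lspan v : A v -> v \in lspan.
Proof.
move=> Av; apply/lspanP; exists [:: (1, v)]; last by rewrite big_seq1 scale1r.
by move=> t; rewrite inE => /eqP->.
Qed.

Lemma lspan_subsemimod_closed : subsemimod_closed lspan.
Proof.
split; first split.
- by apply/lspanP; exists [::]; rewrite ?big_nil.
- move=> u v /lspanP[r rA ->] /lspanP[q qA ->]; apply/lspanP; exists (r ++ q).
    by move=> t; rewrite mem_cat => /orP[/rA|/qA].
  by rewrite big_cat.
- move=> a u /lspanP[r rA ->]; apply/lspanP.
  exists [seq (a * t.1, t.2) | t <- r]; first by move=> _ /mapP[t /rA ? ->].
  by rewrite big_map scaler_sumr; apply: eq_bigr => t _; rewrite scalerA.
Qed.

HB.instance Definition _ := GRing.isSubmodClosed.Build R V lspan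
  lspan_subsemimod_closed.

End Span.

Section Submodules.
Variables (R : nzRingType) (V : lmodType R).

Definition submod (S : submodClosed V) := {v : V | v \in S}.

HB.instance Definition _ (S : submodClosed V) := SubChoice.on (submod S).
HB.instance Definition _ (S : submodClosed V) :=
  [SubChoice_isSubLmodule of submod S by <:].

Definition fin_gen (S : submodClosed V) : Prop :=
  exists r : seq V, S =i lspan [set` r].

(* A strictly increasing chain of n + 1 submodules. *)
Definition has_chain (n : nat) : Prop :=
  exists c : nat -> submodClosed V, forall i, (i < n)%N ->
    {subset c i <= c i.+1} /\ ~ {subset c i.+1 <= c i}.

Definition has_length (n : nat) : Prop :=
  has_chain n /\ forall m, has_chain m -> (m <= n)%N.

Lemma has_length_unique m n : has_length m -> has_length n -> m = n.
Proof. by move=> [cm hm] [cn hn]; apply/eqP; rewrite eqn_leq hm ?hn. Qed.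

End Submodules.
Arguments has_length {R} V n.

Definition lmod_iso (R : nzRingType) (V W : lmodType R) : Prop :=
  exists f : {linear V -> W}, bijective f.

Section Dual.
Variables (R : comNzRingType) (M : lmodType R).

Definition dual_pred : {pred M -> R^o} := [pred f | `[< linear f >] ].

Lemma dual_subsemimod_closed : subsemimod_closed dual_pred.
Proof.
split; first split.
- by apply/asboolP => a u v; rewrite /= scaler0 addr0.
- move=> f g /asboolP lf /asboolP lg; apply/asboolP => a u v.
  by rewrite !addrfctE lf lg scalerDr addrACA.
- move=> b f /asboolP lf; apply/asboolP => a u v.
  by rewrite !scalrfctE lf scalerDr !scalerA mulrC.
Qed.

HB.instance Definition _ := GRing.isSubmodClosed.Build R _ dual_pred
  dual_subsemimod_closed.

Definition dualmod := submod dual_pred.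

End Dual.
Arguments dual_pred {R} M.

HB.instance Definition _ (R : comNzRingType) (M : lmodType R) :=
  GRing.Lmodule.on (dualmod M).

Section Quotient.
Variables (R : nzRingType) (V : lmodType R) (A : set V).

Definition quot_span := Quotient.quot (lspan A).

HB.instance Definition _ := Choice.on quot_span.
HB.instance Definition _ := GRing.Zmodule.on quot_span.
HB.instance Definition _ := EqQuotient.on quot_span.

Definition quot_pi (v : V) : quot_span := \pi_(Quotient.quot (lspan A)) v.
Definition quot_scale (a : R) (x : quot_span) : quot_span :=
  quot_pi (a *: repr x).

Lemma quot_piE u v : quot_pi u = quot_pi v <-> u - v \in lspan A.
Proof. by rewrite Quotient.idealrBE; split=> /eqP. Qed.

Lemma quot_piK x : quot_pi (repr x) = x.
Proof. exact: reprK. Qed.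

Lemma quot_pi_scale a v : quot_scale a (quot_pi v) = quot_pi (a *: v).
Proof. by apply/quot_piE; rewrite -scalerBr rpredZ //; apply/quot_piE/quot_piK. Qed.

Lemma quot_piD u v : quot_pi (u + v) = quot_pi u + quot_pi v.
Proof. exact: Quotient.pi_add. Qed.

Lemma quot_scaleA a b x : quot_scale a (quot_scale b x) = quot_scale (a * b) x.
Proof. by rewrite -[x]quot_piK !quot_pi_scale scalerA. Qed.

Lemma quot_scale1 : left_id 1 quot_scale.
Proof. by move=> x; rewrite -[x]quot_piK quot_pi_scale scale1r. Qed.

Lemma quot_scaleDr : right_distributive quot_scale +%R.
Proof.
move=> a x y; rewrite -[x]quot_piK -[y]quot_piK -quot_piD !quot_pi_scale scalerDr.
exact: quot_piD.
Qed.

Lemma quot_scaleDl x : {morph quot_scale^~ x : a b / a + b}.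
Proof.
move=> a b; rewrite -[x]quot_piK !quot_pi_scale scalerDl; exact: quot_piD.
Qed.

HB.instance Definition _ := GRing.Zmodule_isLmodule.Build R quot_span
  quot_scaleA quot_scale1 quot_scaleDr quot_scaleDl.

Lemma quot_pi_linear : linear quot_pi.
Proof. by move=> a u v; rewrite quot_piD -quot_pi_scale. Qed.

HB.instance Definition _ := GRing.isLinear.Build R V quot_span _ quot_pi
  quot_pi_linear.

End Quotient.

Section Tensor.
Variables (R : comNzRingType) (M N : lmodType R).

Definition tensor_rel : set {freeg (M * N) / R} :=
  [set x | exists (m m' : M) (n : N),
     x = << (m + m', n) >> - << (m, n) >> - << (m', n) >>] `|`
  [set x | exists (m : M) (n n' : N),
     x = << (m, n + n') >> - << (m, n) >> - << (m, n') >>] `|`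
  [set x | exists (a : R) (m : M) (n : N),
     x = << (a *: m, n) >> - << a *g (m, n) >>] `|`
  [set x | exists (a : R) (m : M) (n : N),
     x = << (m, a *: n) >> - << a *g (m, n) >>].

Definition tensor := quot_span tensor_rel.

HB.instance Definition _ := GRing.Lmodule.on tensor.

Definition tens (m : M) (n : N) : tensor := quot_pi tensor_rel << (m, n) >>.

Lemma tensor_universal (P : lmodType R) (b : M -> N -> P) :
  (forall n, linear (b^~ n)) -> (forall m, linear (b m)) ->
  exists! f : tensor -> P, linear f /\ forall m n, f (tens m n) = b m n.
Proof.
move=> bl br; pose h := fglift (fun x : M * N => b x.1 x.2).
have hB : {morph h : x y / x - y} by exact: lift_is_additive.
have hU a m n : h << a *g (m, n) >> = a *: b m n by rewrite /h liftU.
have fgE (x : {freeg (M * N) / R}) :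
    x = \sum_(z <- dom x) coeff z x *: << z >>.
  rewrite -[LHS]freeg_sumE; apply: eq_bigr => z _.
  by apply/eqP/freeg_eqP => y; rewrite coeffZ !coeffU mul1r.
have h0 : h 0 = 0 by rewrite -(subrr 0) hB subrr.
have hN y : h (- y) = - h y by rewrite -sub0r hB h0 sub0r.
have hD : {morph h : x y / x + y}.
  by move=> x y; rewrite -{1}[y]opprK hB hN opprK.
have hZ a x : h (a *: x) = a *: h x.
  rewrite (fgE x) scaler_sumr !(big_morph h hD h0) scaler_sumr.
  apply: eq_bigr => -[m n] _; rewrite scalerA.
  have cU c : c *: << (m, n) >> = << c *g (m, n) >> :> {freeg (M * N) / R}.
    by apply/eqP/freeg_eqP => y; rewrite coeffZ !coeffU mul1r.
  by rewrite !cU !hU scalerA.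
have hrel x : tensor_rel x -> h x = 0.
  have [bl1 br1] : (forall m m' n, b (m + m') n = b m n + b m' n) /\
      (forall m n n', b m (n + n') = b m n + b m n').
    split=> [m m' n|m n n'].
      by rewrite -[m in LHS]scale1r bl scale1r.
    by rewrite -[n in LHS]scale1r br scale1r.
  have [bl0 br0] : (forall n, b 0 n = 0) /\ (forall m, b m 0 = 0).
    split=> z.
      by apply: (addrI (b 0 z)); rewrite -bl1 !addr0.
    by apply: (addrI (b z 0)); rewrite -br1 !addr0.
  move=> [[[|]|]|] [a [m [n ->]]]; rewrite !hB !hU !scale1r.
  - by rewrite bl1 addrAC addrK subrr.
  - by rewrite br1 addrAC addrK subrr.
  - by rewrite -[a *: m]addr0 bl bl0 addr0 subrr.
  - by rewrite -[a *: n]addr0 br br0 addr0 subrr.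
have hspan x : x \in lspan tensor_rel -> h x = 0.
  move=> /lspanP[r rA ->]; rewrite (big_morph h hD h0) big_seq big1 // => t tr.
  by rewrite hZ hrel ?scaler0 //; exact: rA.
have hpi x : h (repr (quot_pi tensor_rel x)) = h x.
  by apply/eqP; rewrite -subr_eq0 -hB hspan //; apply/quot_piE/quot_piK.
exists (fun x : tensor => h (repr x)); split; first split.
- move=> a u v; rewrite -[u]quot_piK -[v]quot_piK -quot_pi_linear !hpi.
  by rewrite hD hZ.
- by move=> m n; rewrite /tens hpi hU scale1r.
- move=> f [fl fb]; apply/funext => x; rewrite -[x in RHS]quot_piK.
  rewrite (fgE (repr x)).
  pose F : {linear tensor -> P} :=
    HB.pack f (GRing.isLinear.Build R tensor P _ f fl).
  rewrite -[f _]/(F _) (big_morph h hD h0) !linear_sum.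
  by apply: eq_bigr => -[m n] _; rewrite !linearZ hZ hU scale1r -fb.
Qed.

End Tensor.

Section Torsion.
Variables (R : idomainType) (M : lmodType R).

Definition torsion : {pred M} :=
  [pred m | `[< exists2 r : R, r != 0 & r *: m = 0 >] ].

Lemma torsion_subsemimod_closed : subsemimod_closed torsion.
Proof.
split; first split.
- by apply/asboolP; exists 1; rewrite ?oner_neq0 ?scaler0.
- move=> u v /asboolP[a a0 au] /asboolP[b b0 bv]; apply/asboolP.
  exists (a * b); first by rewrite mulf_neq0.
  by rewrite scalerDr mulrC -scalerA au mulrC -scalerA bv !scaler0 addr0.
- move=> b u /asboolP[a a0 au]; apply/asboolP; exists a => //.
  by rewrite scalerA mulrC -scalerA au scaler0.
Qed.

HB.instance Definition _ := GRing.isSubmodClosed.Build R M torsion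
  torsion_subsemimod_closed.

End Torsion.
Arguments torsion {R} M.

Section SemigroupAlgebra.
Variables (k : fieldType) (G : addrClosed nat).

Definition sgalg_pred : {pred {poly k}} :=
  lspan [set 'X^g | g in [set` G] ].

HB.instance Definition _ := GRing.SubmodClosed.on sgalg_pred.

Lemma sgalg_pred1 : 1 \in sgalg_pred.
Proof. by apply: mem_lspan; exists 0; rewrite ?expr0 //=; exact: (rpred0 G). Qed.

Lemma sgalg_predM : GRing.mulr_2closed sgalg_pred.
Proof.
move=> p q /lspanP[r rA ->] /lspanP[t tA ->].
rewrite mulr_suml big_seq rpred_sum // => u /rA[g Gg /= <-].
rewrite mulr_sumr big_seq rpred_sum // => v /tA[h Gh /= <-].
rewrite -scalerAl -scalerAr !rpredZ // mem_lspan // -exprD.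
by exists (g + h)%N => //=; exact: (rpredD (S := G)).
Qed.

Lemma sgalg_predV : GRing.invr_closed sgalg_pred.
Proof.
move=> p Gp; have [pU|/invr_out->//] := boolP (p \is a GRing.unit).
have : (p^-1 \is a GRing.unit) by rewrite unitrV.
rewrite poly_unitE => /andP[/eqP s1 _].
rewrite (size1_polyC (eq_leq s1)) -alg_polyC rpredZ //; exact: sgalg_pred1.
Qed.

Lemma sgalg_divring_closed : GRing.divring_closed sgalg_pred.
Proof.
split; first exact: sgalg_pred1.
  by move=> p q Gp Gq; rewrite /sgalg_pred -scaleN1r rpredD // rpredZ.
by move=> p q Gp Gq; rewrite sgalg_predM ?sgalg_predV.
Qed.

HB.instance Definition _ := GRing.isDivringClosed.Build _ sgalg_pred
  sgalg_divring_closed.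

Definition sgalg := {p : {poly k} | p \in sgalg_pred}.

HB.instance Definition _ := SubChoice.on sgalg.
HB.instance Definition _ := [SubChoice_isSubIntegralDomain of sgalg by <:].

End SemigroupAlgebra.
Arguments sgalg_pred : clear implicits.

(* The field k(x), seen as a k[G]-module; [ratfun_frac] below shows that it is
   the field of fractions of k[G] when G has finite complement. *)
Definition ratfun (k : fieldType) (G : addrClosed nat) := {fraction {poly k}}.

HB.instance Definition _ (k : fieldType) (G : addrClosed nat) :=
  GRing.Field.on (ratfun k G).

Section RationalFunctions.
Variables (k : fieldType) (G : addrClosed nat).
Local Notation R := (sgalg k G).
Local Notation K := (ratfun k G).

Definition sgalg_frac (p : R) : K := tofrac (val p).

Lemma sgalg_frac_is_zmod_morphism : zmod_morphism sgalg_frac.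
Proof. by move=> p q; rewrite /sgalg_frac !rmorphB. Qed.

Lemma sgalg_frac_is_monoid_morphism : monoid_morphism sgalg_frac.
Proof.
by split=> [|p q]; rewrite /sgalg_frac ?rmorph1 // !rmorphM.
Qed.

HB.instance Definition _ := GRing.isZmodMorphism.Build R K sgalg_frac
  sgalg_frac_is_zmod_morphism.
HB.instance Definition _ := GRing.isMonoidMorphism.Build R K sgalg_frac
  sgalg_frac_is_monoid_morphism.

Definition ratfun_scale (p : R) (f : K) : K := sgalg_frac p * f.

Lemma ratfun_scaleA p q f :
  ratfun_scale p (ratfun_scale q f) = ratfun_scale (p * q) f.
Proof. by rewrite /ratfun_scale mulrA -rmorphM. Qed.

Lemma ratfun_scale1 : left_id 1 ratfun_scale.
Proof. by move=> f; rewrite /ratfun_scale rmorph1 mul1r. Qed.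

Lemma ratfun_scaleDr : right_distributive ratfun_scale +%R.
Proof. by move=> p f g; rewrite /ratfun_scale mulrDr. Qed.

Lemma ratfun_scaleDl f : {morph ratfun_scale^~ f : p q / p + q}.
Proof. by move=> p q; rewrite /ratfun_scale rmorphD mulrDl. Qed.

HB.instance Definition _ := GRing.Zmodule_isLmodule.Build R K
  ratfun_scaleA ratfun_scale1 ratfun_scaleDr ratfun_scaleDl.

Lemma sgalg_frac_inj : injective sgalg_frac.
Proof. by move=> p q /eqP; rewrite tofrac_eq => /eqP/val_inj. Qed.

Lemma sgalg_conductor (p : {poly k}) (c : nat) :
  (forall n, (c <= n)%N -> n \in G) -> 'X^c * p \in sgalg_pred k G.
Proof.
move=> hc; rewrite -[p]coefK poly_def mulr_sumr rpred_sum // => i _.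
rewrite -scalerAr -exprD rpredZ // mem_lspan //.
by exists (c + i)%N; rewrite //= hc // leq_addr.
Qed.

Lemma ratfun_frac (f : K) : finite_set (~` [set` G]) ->
  exists p q : R, q != 0 /\ f = sgalg_frac p / sgalg_frac q.
Proof.
move=> /finite_seqP[r Gr]; pose c := (\max_(i <- r) i).+1.
have hc n : (c <= n)%N -> n \in G.
  move=> cn; apply: contraT => nG; have : (~` [set` G]) n by exact/negP.
  rewrite Gr /= => nr; suff : (n < n)%N by rewrite ltnn.
  by apply: leq_trans cn; rewrite ltnS; exact: leq_bigmax_seq.
have [p [q [q0 ->]]] : exists p q, q != 0 /\ f = tofrac p / tofrac q :> K.
  elim/quotW: f => x; exists (frac x).1, (frac x).2; split.
    exact: denom_ratioP.
  have x2 : tofrac (frac x).2 != 0 by rewrite tofrac_eq0 denom_ratioP.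
  apply/esym/(canLR (mulfK x2)).
  unlock tofrac; rewrite -[RHS]FracField.pi_mul; apply/eqmodP => /=.
  rewrite FracField.equivfE /FracField.mulf !numden_Ratio ?oner_eq0 ?mulr1 //.
  - by rewrite mul1r.
  - exact: denom_ratioP.
  - exact: denom_ratioP.
exists (Sub ('X^c * p) (sgalg_conductor p hc)).
exists (Sub ('X^c * q) (sgalg_conductor q hc)).
have Xc0 : 'X^c != 0 :> {poly k} by rewrite expf_neq0 // polyX_eq0.
split; first by rewrite -val_eqE /= mulf_neq0.
rewrite /sgalg_frac /= !rmorphM invfM mulrACA divff ?mul1r //.
by rewrite tofrac_eq0.
Qed.

Definition fractional_ideal (I : submodClosed K) : Prop :=
  fin_gen I /\ exists2 f, f \in I & f != 0.

(* The monomial x^n as an element of k(x). *)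
Definition xpow (n : nat) : K := tofrac 'X^n.

End RationalFunctions.

Section ArithmeticSequences.
Variables (G : addrClosed nat) (s : nat).
Local Open Scope nat_scope.

(* Terms lie in G, so sequences of integers over G are sequences of naturals.
   [aseq x n] is (x, x + s, ..., x + n s), with n steps and n + 1 terms. *)
Definition aseq (x n : nat) : seq nat := [seq x + i * s | i <- iota 0 n.+1].

Definition arith_seq (q : seq nat) : Prop :=
  exists x n, [/\ 0 < n, q = aseq x n & {subset q <= G}].

Definition arith_seq_sum (q r t : seq nat) : Prop :=
  exists y a z b, [/\ q = aseq y a, r = aseq z b & t = aseq (y + z) (a + b)].

Definition irreducible_arith_seq (t : seq nat) : Prop :=
  arith_seq t /\
  ~ exists q r, [/\ arith_seq q, arith_seq r & arith_seq_sum q r t].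

End ArithmeticSequences.

(* Main.v *)
From HB Require Import structures.
Require Import Defs.
From mathcomp Require Import all_boot all_order all_algebra.
From mathcomp Require Import boolp classical_sets functions cardinality.
From mathcomp Require Import freeg zify.

Set Implicit Arguments.
Unset Strict Implicit.
Unset Printing Implicit Defensive.

Import GRing.Theory.
Local Open Scope card_scope.
Local Open Scope classical_set_scope.
Local Open Scope ring_scope.

(** Write R = k[G], and let J = (1, x^s), A = span of the x^g with g and g + s
    in G.  Evaluation at 1 identifies J^* with A, since phi(x^s) must be
    x^s phi(1).  Every element of J (x) J^* is 1 (x) phi + x^s (x) psi, and the
    torsion submodule is the kernel of the evaluation J (x) J^* -> R, because R
    is a domain and the kernel is killed by x^c for large c.  So in a torsion
    element phi(1) = - psi(x^s), and the element is determined by v = psi(1).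
    Such a v is exactly a combination of monomials x^n with n, n + s and
    n + 2s in G ([triple_start_coef], [triple_start_torsion]).

    When is the torsion element of v zero?  If v = x^(g + h) with x^g and x^h in
    A, then x^s (x) x^(g + h) = x^(g + s) (x) x^h = 1 (x) x^(g + h + s), so it
    vanishes ([tens_e1_sum_ideal]).  Conversely the class of v modulo the ideal
    spanned by these x^(g + h) is a well-defined function of the tensor
    ([tensor_to_quotient]).  Hence the torsion has a k-basis indexed by the
    finite set of starts n of triples (n, n + s, n + 2s) over G which are not
    sums of starts g, h of pairs (g, g + s), (h, h + s) over G.  A triple can
    only split as a sum of two pairs, so these n are the starts of the
    irreducible triples ([irreducible_triple]).

    Finally the length equals the k-dimension: multiplication by an element of R
    never lowers exponents, so R acts on the basis of monomials by triangular
    matrices ([has_length_triangular]).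

    The module is handled through a presentation only: generators e0, e1 with
    a e0 + b e1 = 0 if and only if a + x^s b = 0.  This covers every ideal
    isomorphic to J at once, and the ring k[G] enters as an abstract domain that
    embeds into k[x] with image k[G]. *)

(** * Length of a module with triangular coordinates *)

(** The coordinates identify V with k^N, and the vectors whose first N - j
    coordinates vanish form the j-th term of a chain, which triangularity makes
    R-stable.  No chain is longer: vectors picked in the successive differences
    of a chain are linearly independent over k. *)
Lemma has_length_triangular (k : fieldType) (R : nzRingType)
    (cst : {rmorphism k -> R}) (V : lmodType R) (N : nat)
    (coord : V -> 'rV[k]_N) :
    (forall a u v, coord (cst a *: u + v) = a *: coord u + coord v) ->
    (forall v, coord v = 0 -> v = 0) ->
    (forall r v (j : nat), (forall i : 'I_N, (i < j)%N -> coord v 0 i = 0) ->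
      forall i : 'I_N, (i < j)%N -> coord (r *: v) 0 i = 0) ->
    (forall j : 'I_N, exists v, coord v = delta_mx 0 j) ->
  has_length V N.
Proof.
move=> coordP coord_inj coord_tri coord_delta.
have coordD u v : coord (u + v) = coord u + coord v.
  by have := coordP 1 u v; rewrite rmorph1 !scale1r.
have coord0 : coord 0 = 0 by apply: (addrI (coord 0)); rewrite -coordD !addr0.
split.
  (* The term of index j has dimension j. *)
  pose A j := [set v : V | forall i : 'I_N, (i + j < N)%N -> coord v 0 i = 0].
  have lspanA j v : v \in lspan (A j) -> A j v.
    case/lspanP=> r rA ->; rewrite big_seq.
    elim/big_ind: _ => [i _|u w Au Aw i iN|t /rA At i iN].
    - by rewrite coord0 mxE.
    - by rewrite coordD mxE Au ?Aw ?addr0.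
    - apply: (coord_tri _ _ (N - j)%N) => [i'|]; rewrite ltn_subRL addnC //.
      exact: At.
  exists (fun j => lspan (A j) : submodClosed V) => j jN.
  split=> [v /lspanA Av|].
    apply: mem_lspan => i iN; apply: Av.
    by apply: ltn_trans iN; rewrite ltn_add2l.
  have jN' : (N - j.+1 < N)%N by rewrite ltn_subrL; case: (N) jN.
  have [v vE] := coord_delta (Ordinal jN').
  move=> /(_ v) sub; have /sub/lspanA Av : v \in lspan (A j.+1).
    apply: mem_lspan => i iN; rewrite vE mxE eqxx.
    by case: eqP => // iE; move: iN; rewrite iE /= subnK ?ltnn.
  have /eqP : 1 = 0 :> k.
    by rewrite -(Av (Ordinal jN')) /=; [rewrite vE mxE !eqxx | lia].
  by rewrite oner_eq0.
move=> m [c cP].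
have /fin_all_exists[v vP] (i : 'I_m) :
    exists v, v \in c i.+1 /\ v \notin c i.
  have [_ nsub] := cP i (ltn_ord i); apply: contrapT => none.
  apply: nsub => v cv.
  by apply/negPn/negP => ncv; apply: none; exists v.
have c_mono i j : (i <= j <= m)%N -> {subset c i <= c j}.
  case/andP; elim: j => [|j IHj]; first by rewrite leqn0 => /eqP-> _ u.
  rewrite leq_eqVlt => /predU1P[-> _ u //|ij jm u cu].
  by apply: (cP j jm).1; apply: IHj cu => //; apply: ltnW.
suff /eqP rankB : row_free (\matrix_(i < m) coord (v i)).
  by rewrite -rankB rank_leq_col.
apply: inj_row_free => a aB; apply/eqP/negPn/negP => /rV0Pn[i0 ai0].
(* In a relation, the vector with the largest index j and a nonzero coefficient
   would be a combination of vectors in the j-th term of the chain. *)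
case: (arg_maxnP (fun i : 'I_m => i : nat) (P := fun i => a 0 i != 0) ai0).
move=> j aj jmax.
have sum0 : \sum_i cst (a 0 i) *: v i = 0.
  apply: coord_inj; rewrite (big_morph coord coordD coord0).
  rewrite -[RHS]aB mulmx_sum_row; apply: eq_bigr => i _.
  by rewrite rowK -[_ *: v i]addr0 coordP coord0 addr0.
have [vj /negP[]] := vP j.
rewrite -[v j]scale1r -(rmorph1 cst) -(mulVf aj) rmorphM -scalerA rpredZ //.
move: sum0; rewrite (bigD1 j) //= => /eqP; rewrite addr_eq0 => /eqP ->.
rewrite -scaleN1r rpredZ // rpred_sum // => i ij.
have [->|ai] := eqVneq (a 0 i) 0; first by rewrite rmorph0 scale0r rpred0.
rewrite rpredZ // (c_mono i.+1) ?(vP i).1 // ltn_neqAle ij andTb.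
apply/andP; split; first exact: jmax.
exact: ltnW (ltn_ord j).
Qed.

(** * Tensor products and duals *)

Section Tensor.
Variables (R : comNzRingType) (M N : lmodType R).
Implicit Types (m : M) (n : N) (t : tensor M N).

Lemma freegU_scale (K : choiceType) (a : R) (z : K) :
  << a *g z >> = a *: << z >> :> {freeg K / R}.
Proof. by apply/eqP/freeg_eqP => y; rewrite coeffZ !coeffU mul1r. Qed.

Lemma tens_linear_l n : linear (@tens R M N ^~ n).
Proof.
move=> a m m'; rewrite /tens -linearZ -linearD -freegU_scale.
transitivity (quot_pi (tensor_rel (M := M) (N := N))
                (<< (a *: m, n) >> + << (m', n) >>)); apply/quot_piE.
  rewrite opprD addrA; apply: mem_lspan; do 3!left.
  by exists (a *: m), m', n.
rewrite opprD addrACA subrr addr0; apply: mem_lspan; left; right.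
by exists a, m, n.
Qed.

Lemma tens_linear_r m : linear (@tens R M N m).
Proof.
move=> a n n'; rewrite /tens -linearZ -linearD -freegU_scale.
transitivity (quot_pi (tensor_rel (M := M) (N := N))
                (<< (m, a *: n) >> + << (m, n') >>)); apply/quot_piE.
  rewrite opprD addrA; apply: mem_lspan; left; left; right.
  by exists m, (a *: n), n'.
rewrite opprD addrACA subrr addr0; apply: mem_lspan; right.
by exists a, m, n.
Qed.

Lemma tensDl m m' n : tens (m + m') n = tens m n + tens m' n.
Proof. by rewrite -[m in LHS]scale1r tens_linear_l scale1r. Qed.

Lemma tensDr m n n' : tens m (n + n') = tens m n + tens m n'.
Proof. by rewrite -[n in LHS]scale1r tens_linear_r scale1r. Qed.

Lemma tens0l n : tens (0 : M) n = 0.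
Proof. by apply: (addrI (tens 0 n)); rewrite -tensDl !addr0. Qed.

Lemma tens0r m : tens m (0 : N) = 0.
Proof. by apply: (addrI (tens m 0)); rewrite -tensDr !addr0. Qed.

Lemma tensZr a m n : tens m (a *: n) = a *: tens m n.
Proof. by rewrite -[a *: n]addr0 tens_linear_r tens0r addr0. Qed.

Lemma tensZl a m n : tens (a *: m) n = tens m (a *: n).
Proof. by rewrite -[a *: m]addr0 tens_linear_l tens0l addr0 tensZr. Qed.

Lemma tensor_ind (P : tensor M N -> Prop) :
  P 0 -> (forall t t', P t -> P t' -> P (t + t')) ->
  (forall m n, P (tens m n)) -> forall t, P t.
Proof.
move=> P0 PD PU t; rewrite -[t]quot_piK -[repr t]freeg_sumE linear_sum.
elim/big_ind: _ => // -[m n] _; set a := coeff _ _.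
rewrite [X in P X](_ : _ = tens m (a *: n)) //.
by rewrite tensZr freegU_scale linearZ.
Qed.

End Tensor.

Section Dual.
Variables (R : comNzRingType) (M : lmodType R).
Implicit Types (phi psi : dualmod M) (m : M).

Lemma dual_valD phi psi m : val (phi + psi) m = val phi m + val psi m.
Proof. by []. Qed.

Lemma dual_valN phi m : val (- phi) m = - val phi m.
Proof. by []. Qed.

Lemma dual_valZ a phi m : val (a *: phi) m = a * val phi m.
Proof.
have -> : val (a *: phi) = a *: val phi by exact: GRing.valZ.
by rewrite scalrfctE.
Qed.

Lemma dual_sum (I : Type) (r : seq I) (P : pred I) (F : I -> dualmod M) m :
  val (\sum_(i <- r | P i) F i) m = \sum_(i <- r | P i) val (F i) m.
Proof. by elim/big_rec2: _ => // i y phi _ <-. Qed.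

Lemma dual_linear phi : linear (val phi).
Proof. by apply/asboolP/(valP phi). Qed.

Lemma dual_val0 phi : val phi 0 = 0.
Proof.
apply: (addrI (val phi 0)).
by rewrite -[X in X + _]scale1r -dual_linear scale1r !addr0.
Qed.

Lemma dual_val0l m : val (0 : dualmod M) m = 0.
Proof. by []. Qed.

End Dual.

(** * Supports of polynomials in the semigroup algebra *)

Section Supports.
Variables (k : fieldType) (G : addrClosed nat).
Local Notation R := (sgalg k G).

Lemma sgalg_coefP (p : {poly k}) :
  reflect (forall i, p`_i != 0 -> i \in G) (p \in sgalg_pred k G).
Proof.
apply: (iffP idP) => [/lspanP[r rG ->] i|pG].
  rewrite coef_sum; apply: contraNT => iG.
  rewrite big_seq big1 // => t /rG[g Gg <-].
  rewrite coefZ coefXn; case: eqP => [ig|]; last by rewrite mulr0.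
  by rewrite ig Gg in iG.
rewrite -[p]coefK poly_def rpred_sum // => i _.
have [->|pi] := eqVneq p`_i 0; first by rewrite scale0r rpred0.
by rewrite rpredZ // mem_lspan //; exists (i : nat) => //; apply: pG.
Qed.

Lemma sgalg_const_subproof (a : k) : a%:P \in sgalg_pred k G.
Proof. by rewrite -alg_polyC rpredZ // sgalg_pred1. Qed.

Definition sgalg_const (a : k) : R := Sub a%:P (sgalg_const_subproof a).

Lemma sgalg_const_is_zmod_morphism : zmod_morphism sgalg_const.
Proof. by move=> a b; apply: val_inj; rewrite /= rmorphB. Qed.

Lemma sgalg_const_is_monoid_morphism : monoid_morphism sgalg_const.
Proof. by split=> [|a b]; apply: val_inj; rewrite /= ?rmorphM. Qed.

HB.instance Definition _ := GRing.isZmodMorphism.Build k R sgalg_const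
  sgalg_const_is_zmod_morphism.
HB.instance Definition _ := GRing.isMonoidMorphism.Build k R sgalg_const
  sgalg_const_is_monoid_morphism.

Lemma coefM_neq0 (p q : {poly k}) n : (p * q)`_n != 0 ->
  exists i j, [/\ n = (i + j)%N, p`_i != 0 & q`_j != 0].
Proof.
move=> pqn; apply: contrapT => none; move/eqP: pqn; apply.
rewrite coefM big1 // => i _; apply/eqP; rewrite mulf_eq0.
apply: contrapT => /negP; rewrite negb_or => /andP[pi qi].
by apply: none; exists (i : nat), (n - i)%N; rewrite subnKC // -ltnS.
Qed.

End Supports.

(** * Arithmetic sequences with two and three terms *)

Section Starts.
Variables (G : addrClosed nat) (s : nat).
Local Open Scope nat_scope.

Definition pair_start (g : nat) := (g \in G) && (g + s \in G).
Definition triple_start (g : nat) := pair_start g && (g + 2 * s \in G).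
Definition sum_start (n : nat) :=
  has (fun g => pair_start g && pair_start (n - g)) (iota 0 n.+1).

Lemma sum_startP n :
  reflect (exists g h, [/\ pair_start g, pair_start h & n = g + h])
          (sum_start n).
Proof.
apply: (iffP hasP) => [[g]|[g [h [Gg Gh ->]]]].
  rewrite mem_iota => gn /andP[Gg Gh]; exists g, (n - g); split => //; lia.
exists g; first by rewrite mem_iota; lia.
by rewrite addKn Gg Gh.
Qed.

Lemma pair_startD a g : a \in G -> pair_start g -> pair_start (a + g).
Proof.
move=> Ga /andP[Gg Ggs]; apply/andP; rewrite -addnA.
by split; apply: (rpredD (S := G)).
Qed.

Lemma sum_startD a n : a \in G -> sum_start n -> sum_start (a + n).
Proof.
move=> Ga /sum_startP[g [h [Gg Gh ->]]]; apply/sum_startP.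
by exists (a + g), h; rewrite addnA pair_startD.
Qed.

Lemma pair_start_conductor c : (forall n, c <= n -> n \in G) ->
  forall n, c <= n -> pair_start n.
Proof. by move=> hc n cn; rewrite /pair_start !hc //; lia. Qed.

Lemma sum_start_conductor c : (forall n, c <= n -> n \in G) ->
  forall n, c + c <= n -> sum_start n.
Proof.
move=> hc n cn; apply/sum_startP; exists c, (n - c).
by split; [apply: (pair_start_conductor hc)..|]; lia.
Qed.

End Starts.

Section Triples.
Variables (G : addrClosed nat) (s : nat).
Local Open Scope nat_scope.

Definition triple (x : nat) := [:: x; x + s; x + 2 * s].

Lemma aseqS x : aseq s x 1 = [:: x; x + s].
Proof. by rewrite /aseq /= mul0n mul1n addn0. Qed.

Lemma aseq_triple x : aseq s x 2 = triple x.
Proof. by rewrite /aseq /= mul0n mul1n addn0. Qed.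

Lemma aseq_inj x y a b : aseq s x a = aseq s y b -> x = y /\ a = b.
Proof.
move=> eq_xy; split; first by case: eq_xy; rewrite !mul0n !addn0.
by have := congr1 size eq_xy; rewrite !size_map !size_iota => -[].
Qed.

Lemma pair_arith_seq g : pair_start G s g <-> arith_seq G s (aseq s g 1).
Proof.
split=> [/andP[Gg Ggs]|[x [n [_ _ sub]]]].
  exists g, 1; split=> // y; rewrite aseqS !inE => /orP[]/eqP-> //.
by rewrite /pair_start !sub // aseqS !inE eqxx ?orbT.
Qed.

(** The numbers of steps of the two summands are positive with sum 2, so both
    summands are pairs. *)
Lemma irreducible_triple g : irreducible_arith_seq G s (triple g) <->
  triple_start G s g && ~~ sum_start G s g.
Proof.
have tripleP : arith_seq G s (triple g) <-> triple_start G s g.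
  split=> [[x [n [_ _ sub]]]|/andP[/andP[Gg Ggs] Gg2]].
    by rewrite /triple_start /pair_start !sub // !inE eqxx ?orbT.
  exists g, 2; split=> //; first by rewrite aseq_triple.
  by move=> y; rewrite !inE => /or3P[]/eqP->.
have sumP : (exists q r, [/\ arith_seq G s q, arith_seq G s r &
    arith_seq_sum s q r (triple g)]) <-> sum_start G s g.
  split=> [[q [r [Gq Gr]]]|/sum_startP[y [z [Gy Gz ->]]]].
    move=> [y [a [z [b [qE rE tE]]]]].
    have pos w d : arith_seq G s (aseq s w d) -> 0 < d.
      by case=> x [n [n0 /aseq_inj[_ ->] _]].
    rewrite qE in Gq; rewrite rE in Gr.
    have a0 := pos _ _ Gq; have b0 := pos _ _ Gr.
    move: tE; rewrite -aseq_triple => /aseq_inj[gE abE].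
    have [a1 b1] : a = 1 /\ b = 1 by lia.
    rewrite a1 in Gq; rewrite b1 in Gr.
    by apply/sum_startP; exists y, z; split=> //; apply/pair_arith_seq.
  exists (aseq s y 1), (aseq s z 1); split; [exact/pair_arith_seq..|].
  by exists y, 1, z, 1; rewrite aseq_triple.
split=> [[/tripleP-> nS]|/andP[gT /negP nS]].
  by apply/negP => /sumP.
by split; [apply/tripleP|move/sumP].
Qed.

End Triples.

(** * Torsion of the tensor product with the dual *)

Section TwoGenerated.
Variables (k : fieldType) (G : addrClosed nat) (s : nat).
Variables (R : idomainType) (cst : {rmorphism k -> R}).
Variable coe : {rmorphism R -> {poly k}}.
Hypothesis coe_cst : forall a, coe (cst a) = a%:P.
Hypothesis coe_inj : injective coe.
Hypothesis coe_mem : forall r, coe r \in sgalg_pred k G.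
Hypothesis coe_surj : forall p, p \in sgalg_pred k G -> exists r, coe r = p.

Lemma coe_coef r i : (coe r)`_i != 0 -> i \in G.
Proof. by move: i; apply/sgalg_coefP. Qed.

(** The choice is unique for g in G; for other g it is the default 0. *)
Definition mon (g : nat) : R := xget 0 [set r | coe r = 'X^g].

Lemma coe_mon g : g \in G -> coe (mon g) = 'X^g.
Proof.
move=> Gg; have [|r rE] := @coe_surj 'X^g; first by apply: mem_lspan; exists g.
by rewrite /mon; case: xgetP => [_ _ //|/(_ r)].
Qed.

Lemma mon_expansion (r : R) :
  r = \sum_(i < size (coe r)) cst (coe r)`_i * mon i.
Proof.
apply: coe_inj; rewrite rmorph_sum -[LHS]coefK poly_def.
apply: eq_bigr => i _; rewrite rmorphM coe_cst mul_polyC.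
have [->|ri] := eqVneq (coe r)`_i 0; first by rewrite !scale0r.
by rewrite coe_mon // (coe_coef ri).
Qed.

Variables (c : nat) (hc : forall n, (c <= n)%N -> n \in G).
Variables (M : lmodType R) (e0 e1 : M).
Hypothesis gen : forall m, exists a b : R, m = a *: e0 + b *: e1.
Hypothesis rel : forall a b : R,
  a *: e0 + b *: e1 = 0 <-> coe a + 'X^s * coe b = 0.
Local Notation D := (dualmod M).

Lemma coords_exist : exists cf : M -> R * R,
  forall m, m = (cf m).1 *: e0 + (cf m).2 *: e1.
Proof.
have /choice[cf cfP] (m : M) : exists ab : R * R, m = ab.1 *: e0 + ab.2 *: e1.
  by have [a [b ->]] := gen m; exists (a, b).
by exists cf.
Qed.

Definition coords : M -> R * R := projT1 (cid coords_exist).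

Lemma coordsE m : m = (coords m).1 *: e0 + (coords m).2 *: e1.
Proof. exact: projT2 (cid coords_exist) m. Qed.

(** A map out of M is defined on chosen coordinates.  It is linear with the
    expected values once the images u, w of e0, e1 satisfy the relations of M,
    which is hypothesis [uw] below. *)
Definition presented_map (W : lmodType R) (u w : W) (m : M) : W :=
  (coords m).1 *: u + (coords m).2 *: w.

Section PresentedMap.
Variables (W : lmodType R) (u w : W).
Hypothesis uw : forall a b : R, coe a + 'X^s * coe b = 0 -> a *: u + b *: w = 0.

Lemma presented_mapE a b :
  presented_map u w (a *: e0 + b *: e1) = a *: u + b *: w.
Proof.
rewrite /presented_map; move: (coordsE (a *: e0 + b *: e1)).
case: (coords _) => a' b' /= /eqP; rewrite -subr_eq0 opprD addrACA -!scalerBl.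
move=> /eqP/rel/uw; rewrite !scalerBl addrACA -opprD => /eqP.
by rewrite subr_eq0 => /eqP.
Qed.

Lemma presented_map_linear : linear (presented_map u w).
Proof.
move=> r m m'; rewrite {1}[m]coordsE {1}[m']coordsE.
rewrite scalerDr addrACA !scalerA -!scalerDl.
by rewrite presented_mapE !scalerDl addrACA -!scalerA -scalerDr.
Qed.

End PresentedMap.

Lemma dualE (phi : D) a b :
  val phi (a *: e0 + b *: e1) = a * val phi e0 + b * val phi e1.
Proof.
by rewrite (dual_linear phi) -[b *: e1]addr0 dual_linear dual_val0 addr0.
Qed.

(** Apply phi to the relation x^(c + s) e0 = x^c e1 and cancel x^c. *)
Lemma dual_shift (phi : D) : coe (val phi e1) = 'X^s * coe (val phi e0).
Proof.
have Gc := hc (leqnn c); have Gcs := hc (leq_addr s c).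
have rel0 : mon (c + s) *: e0 - mon c *: e1 = 0.
  rewrite -scaleNr; apply/rel; rewrite rmorphN !coe_mon //.
  by rewrite mulrN -exprD addnC subrr.
have := dualE phi (mon (c + s)) (- mon c); rewrite scaleNr rel0 dual_val0.
rewrite mulNr => /esym/eqP; rewrite subr_eq0 => /eqP/(congr1 coe).
rewrite !rmorphM !coe_mon // exprD -mulrA => /mulfI -> //.
by rewrite expf_neq0 // polyX_eq0.
Qed.

Lemma dual_inj (phi psi : D) : val phi e0 = val psi e0 -> phi = psi.
Proof.
move=> eq0; have eq1 : val phi e1 = val psi e1.
  by apply: coe_inj; rewrite !dual_shift eq0.
by apply/val_inj/funext => m; rewrite [m]coordsE !dualE eq0 eq1.
Qed.

Lemma dual_exists (u w : R) : coe w = 'X^s * coe u ->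
  exists phi : D, val phi e0 = u /\ val phi e1 = w.
Proof.
move=> uw; pose phi := presented_map (u : R^o) (w : R^o).
have H (a b : R) : coe a + 'X^s * coe b = 0 ->
    a *: (u : R^o) + b *: (w : R^o) = 0.
  move=> ab; rewrite -[LHS]/(a * u + b * w); apply: coe_inj.
  rewrite rmorphD !rmorphM rmorph0 uw.
  by rewrite mulrCA mulrA -mulrDl ab mul0r.
have phiD : phi \in dual_pred M by apply/asboolP/presented_map_linear.
exists (Sub phi phiD); rewrite /= /phi; split.
  by have := presented_mapE H 1 0; rewrite !scale1r !scale0r !addr0.
by have := presented_mapE H 0 1; rewrite !scale1r !scale0r !add0r.
Qed.

(** The ideal spanned by the x^(g + h), for g and h starts of pairs over G.
    Describing it by supports makes membership a condition on coefficients. *)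
Definition sum_ideal : set R^o :=
  [set w | forall n, (coe w)`_n != 0 -> sum_start G s n].

Lemma lspan_sum_ideal (w : R) : (w : R^o) \in lspan sum_ideal -> sum_ideal w.
Proof.
case/lspanP=> r rS ->; rewrite big_seq.
elim/big_ind: _ => [n|u v uS vS n|[a u] /rS uS n].
- by rewrite rmorph0 coef0 eqxx.
- rewrite rmorphD coefD; have [->|/uS //] := eqVneq (coe u)`_n 0.
  by rewrite add0r => /vS.
- rewrite -[a *: u]/(a * u) rmorphM => /coefM_neq0[i [j [-> ai uj]]].
  exact: sum_startD (coe_coef ai) (uS _ uj).
Qed.

Local Notation Q := (quot_span sum_ideal).

(** The representative is arbitrary, so this is only meaningful when n is not a
    sum of starts of pairs. *)
Definition qcoef n (x : Q) : k := (coe (repr x))`_n.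

Lemma qcoef_pi n (w : R) : ~~ sum_start G s n ->
  qcoef n (quot_pi sum_ideal w) = (coe w)`_n.
Proof.
move=> nS.
have /quot_piE/lspan_sum_ideal/(_ n) := quot_piK (quot_pi sum_ideal w).
rewrite rmorphB coefB /qcoef => H; apply/eqP; rewrite -subr_eq0.
by apply: contraNT nS.
Qed.

(** Both phi(e0) and phi(e1) = x^s phi(e0) lie in k[G]. *)
Lemma pair_start_coef (phi : D) n :
  (coe (val phi e0))`_n != 0 -> pair_start G s n.
Proof.
move=> phin; apply/andP; split; first exact: coe_coef phin.
apply: (@coe_coef (val phi e1)).
by rewrite dual_shift coefXnM addnK ltnNge leq_addl.
Qed.

(** The coordinate b is determined up to elements r of R with x^s r in R.  These
    are supported on starts of pairs, as is phi(e0), so r phi(e0) lies in the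
    ideal. *)
Lemma tensor_to_quotient : exists f : {linear tensor M D -> Q},
  forall a b phi,
    f (tens (a *: e0 + b *: e1) phi) = quot_pi sum_ideal (b * val phi e0).
Proof.
pose b m (phi : D) : Q := presented_map 0 (quot_pi sum_ideal (val phi e0)) m.
have H (phi : D) (a r : R) : coe a + 'X^s * coe r = 0 ->
    a *: 0 + r *: quot_pi sum_ideal (val phi e0) = 0.
  move=> ar; rewrite scaler0 add0r -linearZ -[RHS](linear0 (quot_pi sum_ideal)).
  apply/quot_piE; rewrite subr0; apply: mem_lspan => n.
  rewrite -[_ *: _]/(r * val phi e0) rmorphM => /coefM_neq0[i [j [-> ri phij]]].
  apply/sum_startP; exists i, j; split=> //; last exact: pair_start_coef phij.
  rewrite /pair_start (coe_coef ri); apply: (@coe_coef (- a)).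
  move/eqP: ar; rewrite addrC addr_eq0 -rmorphN => /eqP <-.
  by rewrite coefXnM addnK ltnNge leq_addl.
have bl phi : linear (b^~ phi) by apply/presented_map_linear/H.
have br m : linear (b m).
  move=> a phi psi; rewrite /b /presented_map !scaler0 !add0r.
  rewrite dual_valD dual_valZ -[a * _]/(a *: (val phi e0 : R^o)).
  by rewrite linearP scalerDr !scalerA mulrC.
have [f [[fl fb] _]] := tensor_universal bl br.
pose F : {linear tensor M D -> Q} :=
  HB.pack f (GRing.isLinear.Build R (tensor M D) Q _ f fl).
exists F => a r phi; rewrite /F /=.
by rewrite fb /b presented_mapE ?scaler0 ?add0r -?linearZ //; apply: H.
Qed.

Lemma evaluation : exists ev : {linear tensor M D -> R^o},
  forall m phi, ev (tens m phi) = val phi m.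
Proof.
have bl (phi : D) : linear (val phi) by exact: dual_linear.
have br m : linear (fun phi : D => val phi m : R^o).
  by move=> a phi psi; rewrite dual_valD dual_valZ.
have [f [[fl fb] _]] := tensor_universal bl br.
pose F : {linear tensor M D -> R^o} :=
  HB.pack f (GRing.isLinear.Build R (tensor M D) R^o _ f fl).
by exists F.
Qed.

Lemma torsion_evaluation (ev : {linear tensor M D -> R^o}) t :
  t \in torsion (tensor M D) -> ev t = 0.
Proof.
case/asboolP=> r r0 rt; have rev : r * ev t = 0.
  by rewrite -[r * _]/(r *: ev t) -linearZ rt linear0.
by apply/eqP; move/eqP: rev; rewrite mulf_eq0 (negPf r0).
Qed.

Lemma tens_split t : exists phi psi : D, t = tens e0 phi + tens e1 psi.
Proof.
elim/tensor_ind: t => [|_ _ [phi [psi ->]] [phi' [psi' ->]]|m phi].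
- by exists 0, 0; rewrite !tens0r addr0.
- by exists (phi + phi'), (psi + psi'); rewrite !tensDr addrACA.
- exists ((coords m).1 *: phi), ((coords m).2 *: phi).
  by rewrite [m in LHS]coordsE tensDl !tensZl.
Qed.

Lemma torsion_split t : t \in torsion (tensor M D) ->
  exists phi psi : D,
    t = tens e0 phi + tens e1 psi /\ val phi e0 = - val psi e1.
Proof.
move=> tT; have [phi [psi tE]] := tens_split t; exists phi, psi; split=> //.
have [ev evE] := evaluation; have := torsion_evaluation ev tT.
by rewrite tE linearD !evE => /eqP; rewrite addr_eq0 => /eqP.
Qed.

Lemma torsion_tens0 (phi : D) :
  tens e0 phi \in torsion (tensor M D) -> phi = 0.
Proof.
have [ev evE] := evaluation; move=> /(torsion_evaluation ev).
rewrite evE => phi0.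
by apply: dual_inj; rewrite phi0 dual_val0l.
Qed.

Lemma mon_shift_tens g (phi : D) : pair_start G s g ->
  tens e1 (mon g *: phi) = tens e0 (mon (g + s) *: phi).
Proof.
case/andP=> Gg Ggs; rewrite -!tensZl; congr tens; apply/eqP.
rewrite -subr_eq0 addrC -scaleNr; apply/eqP/rel.
by rewrite rmorphN !coe_mon // addnC exprD addNr.
Qed.

Lemma dual_mon g : pair_start G s g -> exists phi : D, val phi e0 = mon g.
Proof.
case/andP=> Gg Ggs; have [|phi [phi0 _]] := @dual_exists (mon g) (mon (g + s)).
  by rewrite !coe_mon // addnC exprD.
by exists phi.
Qed.

(** Monomial by monomial: x^(g + h) = x^g * x^h, and x^g can be moved across the
    tensor sign, where x^g e1 = x^(g + s) e0. *)
Lemma tens_e1_sum_ideal (psi : D) : sum_ideal (val psi e0) ->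
  exists chi : D, tens e1 psi = tens e0 chi.
Proof.
move=> psiS; set v := val psi e0 in psiS.
have /choice[del delP] (n : nat) : exists phi : D, sum_start G s n ->
    val phi e0 = mon n /\ exists chi : D, tens e1 phi = tens e0 chi.
  have [/sum_startP[g [h [Gg Gh ->]]]|] := boolP (sum_start G s n).
    2: by exists 0.
  have [phi phiE] := dual_mon Gh; exists (mon g *: phi) => _; split.
    have [Gg' _] := andP Gg; have [Gh' _] := andP Gh.
    rewrite dual_valZ phiE; apply: coe_inj.
    by rewrite rmorphM !coe_mon ?(rpredD (S := G)) // exprD.
  by exists (mon (g + s) *: phi); apply: mon_shift_tens.
have -> : psi = \sum_(i < size (coe v)) cst (coe v)`_i *: del i.
  apply: dual_inj; rewrite dual_sum [LHS]mon_expansion.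
  apply: eq_bigr => i _; rewrite dual_valZ -/v.
  have [->|/psiS/delP[<- _] //] := eqVneq (coe v)`_i 0.
  by rewrite rmorph0 !mul0r.
rewrite (big_morph (tens e1) (tensDr e1) (tens0r D e1)).
elim/big_ind: _ => [|_ _ [x ->] [y ->]|i _].
- by exists 0; rewrite tens0r.
- by exists (x + y); rewrite tensDr.
- rewrite tensZr; have [->|/psiS/delP[_ [chi ->]]] := eqVneq (coe v)`_i 0.
    by exists 0; rewrite rmorph0 scale0r tens0r.
  by exists (cst (coe v)`_i *: chi); rewrite tensZr.
Qed.

Lemma torsion_eq0 (phi psi : D) :
  tens e0 phi + tens e1 psi \in torsion (tensor M D) ->
  sum_ideal (val psi e0) -> tens e0 phi + tens e1 psi = 0.
Proof.
move=> tT /tens_e1_sum_ideal[chi chiE]; move: tT.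
rewrite chiE -tensDr => tT; rewrite (torsion_tens0 tT).
exact: tens0r.
Qed.

(** Apply [pair_start_coef] to psi and to phi, for phi(e0) = - x^s psi(e0). *)
Lemma triple_start_coef (phi psi : D) n : val phi e0 = - val psi e1 ->
  (coe (val psi e0))`_n != 0 -> triple_start G s n.
Proof.
move=> phipsi psin; rewrite /triple_start (pair_start_coef psin) /=.
have : pair_start G s (n + s).
  apply: (@pair_start_coef phi); rewrite phipsi rmorphN coefN oppr_eq0.
  by rewrite dual_shift coefXnM addnK ltnNge leq_addl.
by case/andP=> _; rewrite mul2n -addnn addnA.
Qed.

(** The element e1 (x) x^g - e0 (x) x^(g + s) is killed by x^c, since
    x^c e1 = x^(c + s) e0. *)
Lemma triple_start_torsion g : triple_start G s g -> exists phi psi : D,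
  val psi e0 = mon g /\ tens e0 phi + tens e1 psi \in torsion (tensor M D).
Proof.
case/andP=> /andP[Gg Ggs] Gg2s.
have [|psi psiE] := @dual_mon g; first by rewrite /pair_start Gg.
have [|phi phiE] := @dual_mon (g + s).
  by rewrite /pair_start Ggs -addnA addnn -mul2n.
exists (- phi), psi; split=> //; apply/asboolP; exists (mon c).
  by rewrite -(inj_eq coe_inj) rmorph0 coe_mon ?hc // expf_neq0 // polyX_eq0.
have Pc := pair_start_conductor s hc (leqnn c); have [Gc Gcs] := andP Pc.
rewrite scalerDr -!tensZr mon_shift_tens // -tensDr.
suff -> : mon c *: - phi + mon (c + s) *: psi = 0 by rewrite tens0r.
apply: dual_inj; rewrite scalerN addrC dual_valD dual_valN !dual_valZ.
rewrite dual_val0l.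
apply: coe_inj; rewrite rmorphB !rmorphM rmorph0 phiE psiE !coe_mon //.
by rewrite -!exprD addnAC -addnA subrr.
Qed.

(** From c + c on, every integer is a sum of starts of pairs, so the bound on n
    loses nothing.  The enumeration is increasing, which is the order in which
    the coordinates below are triangular. *)
Definition irr_starts :=
  [seq n <- iota 0 (c + c) | triple_start G s n && ~~ sum_start G s n].

Lemma mem_irr_starts n :
  (n \in irr_starts) = triple_start G s n && ~~ sum_start G s n.
Proof.
rewrite mem_filter mem_iota /=; case: (ltnP n (c + c)) => [|cn].
  by rewrite andbT.
by rewrite (sum_start_conductor s hc cn) !andbF.
Qed.

(** The coordinates of a torsion element e0 (x) phi + e1 (x) psi are the
    coefficients of psi(e0) at the starts of irreducible triples. *)
Lemma torsion_length :
  has_length (submod (torsion (tensor M D))) (size irr_starts).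
Proof.
have [f fE] := tensor_to_quotient.
pose start i := nth 0%N irr_starts i.
have startP i : (i < size irr_starts)%N ->
    triple_start G s (start i) /\ ~~ sum_start G s (start i).
  by move=> ig; apply/andP; rewrite -mem_irr_starts mem_nth.
have fsplit (phi psi : D) :
    f (tens e0 phi + tens e1 psi) = quot_pi sum_ideal (val psi e0).
  have := fE 0 1 psi; have := fE 1 0 phi; rewrite linearD.
  rewrite !scale1r !scale0r addr0 add0r mul0r mul1r => -> ->.
  by rewrite linear0 add0r.
pose coord (t : submod (torsion (tensor M D))) : 'rV[k]_(size irr_starts) :=
  \row_i qcoef (start i) (f (val t)).
have coordE (t : submod (torsion (tensor M D))) : exists phi psi : D,
    [/\ val t = tens e0 phi + tens e1 psi, val phi e0 = - val psi e1 &
    forall (r : R) i,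
      coord (r *: t) 0 i = (coe r * coe (val psi e0))`_(start i)].
  have [phi [psi [tE phipsi]]] := torsion_split (valP t).
  exists phi, psi; split=> // r i; have [_ nS] := startP i (ltn_ord i).
  rewrite mxE GRing.valZ linearZ /= tE fsplit -linearZ.
  by rewrite qcoef_pi // rmorphM.
apply: (@has_length_triangular k R cst _ _ coord).
- move=> a t t'; apply/rowP => i; rewrite !mxE.
  have [_ nS] := startP i (ltn_ord i).
  have [phi [psi [tE _]]] := torsion_split (valP t).
  have [phi' [psi' [tE' _]]] := torsion_split (valP t').
  rewrite GRing.valD GRing.valZ linearD linearZ /=.
  rewrite tE tE' !fsplit -linearP !qcoef_pi // rmorphD coefD.
  by rewrite rmorphM coe_cst coefCM.
- move=> t t0; have [phi [psi [tE phipsi tc]]] := coordE t.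
  have tT := valP t; apply: val_inj; rewrite /= tE in tT *.
  apply: torsion_eq0 => // n psin; apply: contrapT => /negP nS.
  have nE : n \in irr_starts.
    by rewrite mem_irr_starts nS (triple_start_coef phipsi psin).
  have ni : (index n irr_starts < size irr_starts)%N by rewrite index_mem.
  have := tc 1 (Ordinal ni).
  rewrite scale1r t0 mxE rmorph1 mul1r /start /= nth_index //.
  by move/esym/eqP; rewrite (negPf psin).
- move=> r t j tj i ij; have [phi [psi [tE phipsi tc]]] := coordE t.
  have [_ nS] := startP i (ltn_ord i).
  apply/eqP; rewrite tc; apply: contraNT nS => /coefM_neq0[a [n [gE ra psin]]].
  (* The exponent n <= start i would itself be the start of an irreducible
     triple, at which the coordinate of t vanishes. *)
  rewrite gE; apply: sum_startD; first exact: coe_coef ra.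
  apply: contraT => nS.
  have nE : n \in irr_starts.
    by rewrite mem_irr_starts nS (triple_start_coef phipsi psin).
  have ni : (index n irr_starts < size irr_starts)%N by rewrite index_mem.
  have nle : (index n irr_starts <= i)%N.
    rewrite leqNgt; apply/negP => lt_i.
    have gsorted : sorted ltn irr_starts.
      by apply: sorted_filter (iota_ltn_sorted _ _); apply: ltn_trans.
    have := sorted_ltn_nth ltn_trans 0%N gsorted i _ (ltn_ord i) ni lt_i.
    by rewrite nth_index // -/(start i) gE; lia.
  have := tc 1 (Ordinal ni); rewrite scale1r tj ?(leq_ltn_trans nle) //.
  rewrite rmorph1 mul1r /start /= nth_index // => /esym/eqP.
  by rewrite (negPf psin).
- move=> j; have [gT gS] := startP j (ltn_ord j).
  have [phi [psi [psiE tT]]] := triple_start_torsion gT.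
  exists (Sub (tens e0 phi + tens e1 psi) tT).
  apply/rowP => i; rewrite !mxE /= fsplit.
  have [_ nS] := startP i (ltn_ord i).
  rewrite qcoef_pi // psiE coe_mon; last by case/andP: gT => /andP[].
  rewrite coefXn; congr (nat_of_bool _)%:R.
  by rewrite nth_uniq ?ltn_ord // filter_uniq // iota_uniq.
Qed.

End TwoGenerated.

(** * The length formula *)

Lemma lspan_pair (R : nzRingType) (V : lmodType R) (u w v : V) :
  v \in lspan [set u; w] -> exists a b, v = a *: u + b *: w.
Proof.
case/lspanP=> r rA ->; rewrite big_seq.
elim/big_ind: _ => [|_ _ [a [b ->]] [a' [b' ->]]|[a x] /rA[]/= ->].
- by exists 0, 0; rewrite !scale0r addr0.
- by exists (a + a'), (b + b'); rewrite !scalerDl addrACA.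
- by exists a, 0; rewrite scale0r addr0.
- by exists 0, a; rewrite scale0r add0r.
Qed.

Lemma cofinite_conductor (G : {pred nat}) : finite_set (~` [set` G]) ->
  exists c, forall n, (c <= n)%N -> n \in G.
Proof.
move=> /finite_seqP[r Gr]; exists (\max_(i <- r) i).+1 => n.
apply: contraTT => nG; have nr : [set` r] n by rewrite -Gr; apply/negP.
by rewrite -ltnNge ltnS; apply: leq_bigmax_seq.
Qed.

Theorem proposition4p4 (k : fieldType) (G : addrClosed nat) (s : nat)
    (I : submodClosed (ratfun k G)) :
  finite_set (~` [set` G]) -> (0 < s)%N ->
  fractional_ideal I ->
  lmod_iso (submod I) (submod (lspan [set 1; xpow k G s])) ->
  exists N : nat,
    [set t : seq nat | irreducible_arith_seq G s t /\
       exists x : nat, t = [:: x; x + s; x + 2 * s]%N] #= `I_N /\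
    has_length (submod (torsion (tensor (submod I) (dualmod (submod I))))) N.
Proof.
move=> /cofinite_conductor[c hc] _ _ [h [h' hK h'K]].
exists (size (irr_starts G s c)); split.
  pose f i := triple s (nth 0%N (irr_starts G s c) i).
  rewrite (_ : [set t | _] = f @` `I_(size (irr_starts G s c))).
    apply: inj_card_eq => i j /set_mem /= ig /set_mem /= jg [/eqP].
    by rewrite nth_uniq ?filter_uniq ?iota_uniq // => /eqP.
  apply/seteqP; split=> [t [irr [x tE]]|_ [i ig <-]] /=.
    move: irr; rewrite tE => /irreducible_triple.
    rewrite -(mem_irr_starts s hc) => xg.
    exists (index x (irr_starts G s c)); first by rewrite /= index_mem.
    by rewrite /f nth_index.
  split; last by eexists.
  by apply/irreducible_triple; rewrite -(mem_irr_starts s hc) mem_nth.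
have J1 : (1 : ratfun k G) \in lspan [set 1; xpow k G s].
  by apply: mem_lspan; left.
have Js : xpow k G s \in lspan [set 1; xpow k G s].
  by apply: mem_lspan; right.
pose e0 := h' (Sub 1 J1); pose e1 := h' (Sub (xpow k G s) Js).
have he (a b : sgalg k G) : val (h (a *: e0 + b *: e1)) =
    tofrac (val a + 'X^s * val b) :> ratfun k G.
  rewrite linearD !linearZ /= !h'K rmorphD rmorphM mulrC.
  by rewrite -[LHS]/(tofrac (val a) * 1 + tofrac (val b) * tofrac 'X^s) mulr1.
have sgalgP (p : sgalg k G) : val p \in sgalg_pred k G := valP p.
have sgalg_surj p : p \in sgalg_pred k G -> exists q : sgalg k G, val q = p.
  by move=> pG; exists (Sub p pG).
have gen m : exists a b : sgalg k G, m = a *: e0 + b *: e1.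
  have [a [b hm]] := lspan_pair (valP (h m)); exists a, b.
  apply: (can_inj hK); apply: val_inj; rewrite hm.
  by rewrite linearD !linearZ /= !h'K.
have rel (a b : sgalg k G) :
    a *: e0 + b *: e1 = 0 <-> val a + 'X^s * val b = 0.
  split=> ab0.
    by have /esym/eqP := he a b; rewrite ab0 linear0 tofrac_eq0 => /eqP.
  by apply: (can_inj hK); apply: val_inj; rewrite he ab0 linear0 tofrac0.
have len := @torsion_length k G s _ (sgalg_const G)
  (val : {rmorphism sgalg k G -> {poly k}}) (fun=> erefl) val_inj sgalgP
  sgalg_surj c hc _ e0 e1 gen rel.
(* Once these wrappers are gone, the ring and module instances on both sides
   can be compared argument by argument. *)
rewrite /reverse_coercion in len *.
exact len.
Qed.
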